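(* Let $\mathcal{C}$ be a non-empty k-category and $\mathcal{D}$ a perfect k-category. Then the k-category $\mathrm{Func}(\mathcal{C},\mathcal{D})$ is perfect.
   Context: A k-category is a small category whose object and morphism sets are k-spaces (compactly generated Hausdorff) such that the source, target, identity and composition maps are continuous (products in the category of k-spaces). A non-empty k-category $\mathcal{C}$ is perfect when the map $\mathrm{Mor}(\mathcal{C})\to\mathrm{Ob}(\mathcal{C})\times\mathrm{Ob}(\mathcal{C})$, $f\mapsto(\text{source}(f),\text{target}(f))$, is a homeomorphism. $\mathrm{Func}(\mathcal{C},\mathcal{D})$ is the k-category whose objects are the continuous functors $\mathcal{C}\to\mathcal{D}$, topologized as a subspace of the k-space $\mathrm{Mor}(\mathcal{D})^{\mathrm{Mor}(\mathcal{C})}$, and whose morphisms are continuous natural transformations, topologized as a closed subspace of $\mathrm{Ob}(\mathrm{Func})\times\mathrm{Ob}(\mathrm{Func})\times\mathrm{Mor}(\mathcal{D})^{\mathrm{Ob}(\mathcal{C})}$. *)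

(* Defs.v *)
(* Stdlib/MathComp-classical world: topologies are given explicitly as
   predicates on subsets ("the open sets"), so that k-ifications, k-products,
   subspaces and compact-open function spaces can be built on arbitrary types. *)
From Stdlib Require Lists.List.
From mathcomp Require Import all_boot.
From mathcomp Require Import boolp classical_sets.
Set Implicit Arguments. Unset Strict Implicit. Unset Printing Implicit Defensive.
Local Open Scope classical_set_scope.

Definition topology (T : Type) := set T -> Prop.

Definition is_topology T (o : topology T) : Prop :=
  o setT /\ (forall U V, o U -> o V -> o (U `&` V)) /\
  (forall F : set (set T), (forall U, F U -> o U) -> o (\bigcup_(U in F) U)).

Definition cont S T (oS : topology S) (oT : topology T) (f : S -> T) : Prop :=
  forall V, oT V -> oS (f @^-1` V).

Definition homeo S T (oS : topology S) (oT : topology T) (f : S -> T) : Prop :=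
  exists g : T -> S, cancel f g /\ cancel g f /\ cont oS oT f /\ cont oT oS g.

Definition compact_in T (o : topology T) (K : set T) : Prop :=
  forall C : set (set T), (forall U, C U -> o U) -> K `<=` \bigcup_(U in C) U ->
  exists s : seq (set T), (forall U, Stdlib.Lists.List.In U s -> C U) /\
    K `<=` (fun x => exists2 U, Stdlib.Lists.List.In U s & U x).

Definition hausdorff T (o : topology T) : Prop :=
  forall x y : T, x <> y -> exists U V, [/\ o U, o V, U x, V y &
    forall z, ~ (U z /\ V z)].

Definition is_kspace T (o : topology T) : Prop :=
  [/\ is_topology o, hausdorff o &
      forall U, (forall K, compact_in o K -> exists2 V, o V & U `&` K = V `&` K) -> o U].

Definition kfy T (o : topology T) : topology T :=
  fun U => forall K, compact_in o K -> exists2 V, o V & U `&` K = V `&` K.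

Definition gen_top T (S : set (set T)) : topology T :=
  fun U => forall x, U x -> exists s : seq (set T),
    [/\ forall V, Stdlib.Lists.List.In V s -> S V, forall V, Stdlib.Lists.List.In V s -> V x &
        (fun y => forall V, Stdlib.Lists.List.In V s -> V y) `<=` U].

Definition induced S T (i : S -> T) (oT : topology T) : topology S :=
  fun U => exists2 V, oT V & U = i @^-1` V.

Definition prod_top A B (oA : topology A) (oB : topology B) : topology (A * B) :=
  gen_top (fun W => (exists2 U, oA U & W = (fun p => U p.1)) \/
                    (exists2 V, oB V & W = (fun p => V p.2))).

Definition kprod A B (oA : topology A) (oB : topology B) : topology (A * B) :=
  kfy (prod_top oA oB).

Definition ksub S T (i : S -> T) (oT : topology T) : topology S := kfy (induced i oT).

Definition cmap X Y (oX : topology X) (oY : topology Y) :=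
  {f : X -> Y | cont oX oY f}.

Definition cmap_top X Y (oX : topology X) (oY : topology Y) : topology (cmap oX oY) :=
  kfy (gen_top (fun W => exists K U, [/\ compact_in oX K, oY U &
        W = (fun f : cmap oX oY => forall x, K x -> U (sval f x))])).

(** k-categories.  [comp f g] is "g after f", meaningful when [tgt f = src g]. *)
Record kcat := KCat {
  Ob : Type; Mor : Type;
  topOb : topology Ob; topMor : topology Mor;
  src : Mor -> Ob; tgt : Mor -> Ob; idm : Ob -> Mor;
  comp : Mor -> Mor -> Mor }.

Arguments topOb k : clear implicits. Arguments topMor k : clear implicits.
Arguments src {k}. Arguments tgt {k}. Arguments idm {k}. Arguments comp {k}.

Definition kcomposable (C : kcat) := {p : Mor C * Mor C | tgt p.1 = src p.2}.

Definition kcomposable_top (C : kcat) : topology (kcomposable C) :=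
  ksub (fun p : kcomposable C => sval p) (kprod (topMor C) (topMor C)).

Arguments kcomposable_top C : clear implicits.

Definition is_kcat (C : kcat) : Prop :=
  [/\ is_kspace (topOb C), is_kspace (topMor C),
      [/\ cont (topMor C) (topOb C) src, cont (topMor C) (topOb C) tgt,
          cont (topOb C) (topMor C) idm &
          cont (kcomposable_top C) (topMor C)
               (fun p : kcomposable C => comp (sval p).1 (sval p).2)] &
      [/\ forall x : Ob C, src (idm x) = x /\ tgt (idm x) = x,
          forall f g : Mor C, tgt f = src g -> src (comp f g) = src f /\ tgt (comp f g) = tgt g,
          forall f : Mor C, comp (idm (src f)) f = f /\ comp f (idm (tgt f)) = f &
          forall f g h : Mor C, tgt f = src g -> tgt g = src h ->
            comp (comp f g) h = comp f (comp g h)]].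

Definition nonempty_kcat (C : kcat) : Prop := inhabited (Ob C).

(** Perfectness, stated for the underlying data (objects, morphisms, source,
    target) so that it applies both to a kcat and to Func(C,D). *)
Definition perfect_data O M (oO : topology O) (oM : topology M) (s t : M -> O) : Prop :=
  inhabited O /\ homeo oM (kprod oO oO) (fun f => (s f, t f)).

Definition perfect (C : kcat) : Prop :=
  perfect_data (topOb C) (topMor C) src tgt.

Definition is_functor (C D : kcat) (Fo : Ob C -> Ob D) (Fm : Mor C -> Mor D) : Prop :=
  [/\ forall f, src (Fm f) = Fo (src f), forall f, tgt (Fm f) = Fo (tgt f),
      forall x, Fm (idm x) = idm (Fo x) &
      forall f g, tgt f = src g -> Fm (comp f g) = comp (Fm f) (Fm g)].

Record cfunctor (C D : kcat) := CFunctor {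
  fo : Ob C -> Ob D; fm : Mor C -> Mor D;
  fun_ax : is_functor fo fm;
  fo_cont : cont (topOb C) (topOb D) fo;
  fm_cont : cont (topMor C) (topMor D) fm }.

Definition fm_map (C D : kcat) (F : cfunctor C D) : cmap (topMor C) (topMor D) :=
  exist _ (fm F) (fm_cont F).

Definition FuncOb_top (C D : kcat) : topology (cfunctor C D) :=
  ksub (@fm_map C D) (@cmap_top _ _ (topMor C) (topMor D)).

Arguments FuncOb_top C D : clear implicits.

Record ctrans (C D : kcat) := CTrans {
  tdom : cfunctor C D; tcod : cfunctor C D;
  teta : Ob C -> Mor D;
  teta_cont : cont (topOb C) (topMor D) teta;
  teta_src : forall x, src (teta x) = fo tdom x;
  teta_tgt : forall x, tgt (teta x) = fo tcod x;
  teta_nat : forall f, comp (fm tdom f) (teta (tgt f)) = comp (teta (src f)) (fm tcod f) }.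

Definition ctrans_emb (C D : kcat) (t : ctrans C D) :
  (cfunctor C D * cfunctor C D) * cmap (topOb C) (topMor D) :=
  ((tdom t, tcod t), exist _ (teta t) (teta_cont t)).

Definition FuncMor_top (C D : kcat) : topology (ctrans C D) :=
  ksub (@ctrans_emb C D)
       (kprod (kprod (FuncOb_top C D) (FuncOb_top C D)) (@cmap_top _ _ (topOb C) (topMor D))).

Arguments FuncMor_top C D : clear implicits.

(* Main.v *)
(* In a perfect k-category D every pair of objects (a, b) is joined by exactly
   one morphism g (a, b), and g is continuous.  So between two functors F, G
   there is exactly one natural transformation, x |-> g (F x, G x), naturality
   being automatic since parallel morphisms coincide; hence (dom, cod) is a
   bijection from Mor Func(C,D) onto the k-product of Ob Func(C,D) with itself.
   It is continuous as a projection.  Continuity of its inverse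
   (F, G) |-> g (F -, G -) comes down to: for K compact in Ob C and W open in the
   k-product Ob D x Ob D, the set of (F, G) with (F x, G x) in W for all x in K
   is open in the k-product.  For a product-open W this is a tube-lemma argument,
   using that Ob C is Hausdorff to find compact neighbourhoods inside boxes; the
   k-ification is handled by testing against compact sets Q of pairs, whose image
   {(F x, G x) | (F, G) in Q, x in K} is again compact. *)

Require Import Defs.
From mathcomp Require Import all_boot.
From mathcomp Require Import boolp classical_sets.
From Stdlib Require Import
  Lists.List (In, in_app_iff, in_map_iff, in_map, flat_map, in_flat_map).
Set Implicit Arguments. Unset Strict Implicit.
Local Open Scope classical_set_scope.

Section OpenSets.
Variables (T : Type) (o : topology T).
Hypothesis ho : is_topology o.

Lemma openT : o setT. Proof. by case: ho. Qed.

Lemma openI U V : o U -> o V -> o (U `&` V).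
Proof. by case: ho => _ [+ _]; apply. Qed.

Lemma open_bigcup_fam I (P : I -> Prop) (f : I -> set T) :
  (forall i, P i -> o (f i)) -> o (fun y => exists i, P i /\ f i y).
Proof.
case: ho => _ [_ o_bigcup] of_.
have -> : (fun y => exists i, P i /\ f i y) =
          \bigcup_(U in [set U | exists i, P i /\ U = f i]) U.
  apply/predeqP => y; split => [[i [Pi fiy]]|[U [i [Pi ->]] fiy]]; last by exists i.
  by exists (f i) => //; exists i.
by apply: o_bigcup => U [i [Pi ->]]; apply: of_.
Qed.

Lemma open0 : o set0.
Proof.
have -> : (set0 : set T) = (fun y => exists i : False, True /\ set0 y).
  by apply/predeqP => y; split => // -[[]].
by apply: open_bigcup_fam => -[].
Qed.

Lemma open_bigcap_seq I (f : I -> set T) (s : seq I) :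
  (forall i, In i s -> o (f i)) -> o (fun y => forall i, In i s -> f i y).
Proof.
elim: s => [|i s IHs] of_.
  have -> : (fun y => forall i, In i [::] -> f i y) = setT by apply/predeqP.
  exact: openT.
have -> : (fun y => forall j, In j (i :: s) -> f j y) =
          f i `&` (fun y => forall j, In j s -> f j y).
  apply/predeqP => y; split => [fy|[fiy fsy] j [<-|js]]; last exact: fsy.
  - by split => [|j js]; apply: fy; [left|right].
  - exact: fiy.
apply: openI; first by apply: of_; left.
by apply: IHs => j js; apply: of_; right.
Qed.

End OpenSets.

Lemma cont_const S T (oS : topology S) (oT : topology T) (y : T) :
  is_topology oS -> cont oS oT (fun _ => y).
Proof.
move=> hS V _; have [Vy|nVy] := pselect (V y).
- have -> : (fun _ : S => y) @^-1` V = setT by apply/predeqP.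
  exact: openT.
- have -> : (fun _ : S => y) @^-1` V = set0 by apply/predeqP.
  exact: open0.
Qed.

Lemma seq_choice_except A B (P : A -> Prop) (R : A -> B -> Prop) (Q : B -> Prop)
    (s : seq B) :
  (forall b, In b s -> Q b \/ exists2 a, P a & R a b) ->
  exists s' : seq A, (forall a, In a s' -> P a) /\
    forall b, In b s -> ~ Q b -> exists2 a, In a s' & R a b.
Proof.
elim: s => [|b s IHs] hs; first by exists [::].
have [s' [s'P s'R]] := IHs (fun c cs => hs c (or_intror cs)).
have [Qb|[a Pa Rab]] := hs b (or_introl erefl).
  by exists s'; split => // c [<-|cs] //; apply: s'R.
exists (a :: s'); split => [a' [<-|a's']|c [<-|cs] nQc]; [exact: Pa|exact: s'P| |].
- by exists a => //; left.
- by have [a' a's' Ra'c] := s'R c cs nQc; exists a' => //; right.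
Qed.

Section Compactness.
Variables (T : Type) (o : topology T).

Lemma compact_point_subcover K (N : T -> set T) :
  compact_in o K -> (forall x, K x -> o (N x) /\ N x x) ->
  exists xs : seq T, (forall x, In x xs -> K x) /\
    K `<=` (fun y => exists x, In x xs /\ N x y).
Proof.
move=> cK oN.
have [s [sN Kcov]] : exists s : seq (set T),
    (forall U, In U s -> exists2 x, K x & N x = U) /\
    K `<=` (fun y => exists2 U, In U s & U y).
  apply: cK => [U [x Kx <-]|y Ky]; first exact: (oN x Kx).1.
  by exists (N y); [exists y|exact: (oN y Ky).2].
have [xs [xsK xsN]] := seq_choice_except (Q := fun _ => False) (s := s)
  (fun U Us => or_intror (sN U Us)).
exists xs; split => // y /Kcov [U /xsN /(_ id) [x xxs <-] Nxy].
by exists x.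
Qed.

Lemma compact_setD_open K B : compact_in o K -> o B -> compact_in o (K `&` ~` B).
Proof.
move=> cK oB C oC cov.
have [s [sCB Kcov]] : exists s : seq (set T),
    (forall U, In U s -> U = B \/ exists2 V, C V & V = U) /\
    K `<=` (fun y => exists2 U, In U s & U y).
  apply: (cK (fun U => U = B \/ exists2 V, C V & V = U)) => [U [->|[V CV <-]]|y Ky].
  - exact: oB.
  - exact: oC.
  have [By|nBy] := pselect (B y); first by exists B => //; left.
  by have [U CU Uy] := cov y (conj Ky nBy); exists U => //; right; exists U.
have [s' [s'C s's]] := seq_choice_except sCB.
exists s'; split => // y [/Kcov [U Us Uy] nBy].
have UB : U <> B by move=> eUB; apply: nBy; rewrite -eUB.
by have [V s'V eVU] := s's U Us UB; exists V; rewrite // eVU.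
Qed.

Lemma compact_kfy K : compact_in o K -> compact_in (kfy o) K.
Proof.
move=> cK C oC cov.
have fex U : exists V, C U -> o V /\ U `&` K = V `&` K.
  have [CU|nCU] := pselect (C U); last by exists setT.
  by have [V oV e] := oC U CU K cK; exists V.
have [f fP] := choice fex.
have [s [sf Kcov]] : exists s : seq (set T),
    (forall V, In V s -> exists2 U, C U & f U = V) /\
    K `<=` (fun y => exists2 V, In V s & V y).
  apply: cK => [V [U CU <-]|y Ky]; first exact: (fP U CU).1.
  have [U CU Uy] := cov y Ky; exists (f U); first by exists U.
  by have [] : (f U `&` K) y by rewrite -(fP U CU).2.
have [s' [s'C s's]] := seq_choice_except (Q := fun _ => False) (s := s)
  (fun V Vs => or_intror (sf V Vs)).
exists s'; split => // y Ky; have [V /s's /(_ id) [U s'U <-] fUy] := Kcov y Ky.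
by exists U => //; have [] : (U `&` K) y by rewrite (fP U (s'C U s'U)).2.
Qed.

Lemma hausdorff_compact_shrink K x O :
  is_topology o -> hausdorff o -> compact_in o K -> o O -> O x ->
  exists P K', [/\ o P, P x, compact_in o K', K' `<=` O & P `&` K `<=` K'].
Proof.
move=> ho hs cK oO Ox.
have cKO := compact_setD_open cK oO.
have fex z : exists UV : set T * set T, (K `&` ~` O) z ->
    [/\ o UV.1, o UV.2, UV.1 x, UV.2 z & forall w, ~ (UV.1 w /\ UV.2 w)].
  have [[Kz nOz]|nKOz] := pselect ((K `&` ~` O) z); last by exists (setT, setT).
  have /hs [U [V sep]] : x <> z by move=> e; apply: nOz; rewrite -e.
  by exists (U, V).
have [f fP] := choice fex.
have [zs [zsK zscov]] := compact_point_subcover (N := fun z => (f z).2) cKO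
  (fun z KOz => let: And5 _ oV _ Vz _ := fP z KOz in conj oV Vz).
pose P y := forall z, In z zs -> (f z).1 y.
pose W y := exists z, In z zs /\ (f z).2 y.
exists P, (K `&` ~` W); split.
- by apply: open_bigcap_seq => // z /zsK /fP [].
- by move=> z /zsK /fP [].
- by apply: compact_setD_open => //; apply: open_bigcup_fam => // z /zsK /fP [].
- move=> y [Ky nWy]; have [//|nOy] := pselect (O y).
  by case: nWy; apply: zscov.
- move=> y [Py Ky]; split => // -[z [zzs Vy]].
  by have [_ _ _ _ disj] := fP z (zsK z zzs); apply: (disj y); split => //; apply: Py.
Qed.
End Compactness.

Lemma cont_comp X Y Z (oX : topology X) (oY : topology Y) (oZ : topology Z) f g :
  cont oX oY f -> cont oY oZ g -> cont oX oZ (fun x => g (f x)).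
Proof. by move=> cf cg V /cg /cf. Qed.

Lemma compact_image X Y (oX : topology X) (oY : topology Y) (h : X -> Y) K :
  compact_in oX K -> cont oX oY h -> compact_in oY (h @` K).
Proof.
move=> cK ch C oC cov.
have fex x : exists U, K x -> C U /\ U (h x).
  have [Kx|nKx] := pselect (K x); last by exists setT.
  by have [U CU Uhx] := cov (h x) (ex_intro2 _ _ x Kx erefl); exists U.
have [f fP] := choice fex.
have [xs [xsK Kcov]] := compact_point_subcover (N := fun x => h @^-1` f x) cK
  (fun x Kx => conj (ch _ (oC _ (fP x Kx).1)) (fP x Kx).2).
exists (map f xs); split => [U /in_map_iff [x [<- xxs]]|_ [x /Kcov [z [zxs fzhx]] <-]].
- exact: (fP x (xsK x xxs)).1.
- by exists (f z) => //; apply: in_map.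
Qed.

Lemma open_kfy T (o : topology T) U : o U -> kfy o U.
Proof. by move=> oU K _; exists U. Qed.

Lemma kfy_topology T (o : topology T) : is_topology o -> is_topology (kfy o).
Proof.
move=> ho; split; first exact: open_kfy (openT ho).
split=> [U V kU kV K cK|F kF K cK].
  have [U' oU' eU] := kU K cK; have [V' oV' eV] := kV K cK.
  exists (U' `&` V'); first exact: openI.
  by rewrite -[K]setIid setIACA eU eV -setIACA.
have fex U : exists V, F U -> o V /\ U `&` K = V `&` K.
  have [FU|nFU] := pselect (F U); last by exists setT.
  by have [V oV e] := kF U FU K cK; exists V.
have [f fP] := choice fex.
exists (fun y => exists U, F U /\ f U y).
  by apply: open_bigcup_fam => // U /fP [].
apply/predeqP => x; split=> [[[U FU Ux] Kx]|[[U [FU fUx]] Kx]]; split => //.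
- by exists U; split => //; have [] : (f U `&` K) x by rewrite -(fP U FU).2.
- by exists U => //; have [] : (U `&` K) x by rewrite (fP U FU).2.
Qed.

Lemma cont_kfy_dom X Y (oX : topology X) (oY : topology Y) h :
  cont oX oY h -> cont (kfy oX) oY h.
Proof. by move=> ch V /ch /open_kfy. Qed.

Lemma cont_kfy X Y (oX : topology X) (oY : topology Y) h :
  cont (kfy oX) oY h -> cont (kfy oX) (kfy oY) h.
Proof.
move=> ch U kU K cK.
have [W oW eW] := kU _ (compact_image (compact_kfy cK) ch).
have [V oV eV] := ch W oW K cK.
exists V => //; rewrite -eV; apply/predeqP => x; split=> -[Uhx Kx]; split => //.
- by have [] : (W `&` h @` K) (h x) by rewrite -eW; split => //; exists x.
- by have [] : (U `&` h @` K) (h x) by rewrite eW; split => //; exists x.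
Qed.

Lemma cont_kspace_dom X Y (oX : topology X) (oY : topology Y) h :
  is_kspace oX -> cont (kfy oX) oY h -> cont oX oY h.
Proof. by move=> [_ _ kX] ch V /ch /kX. Qed.

Lemma cont_induced R S T (i : S -> T) (oR : topology R) (oT : topology T) (f : R -> S) :
  cont oR oT (fun r => i (f r)) -> cont oR (induced i oT) f.
Proof. by move=> cif _ [V oV ->]; apply: cif. Qed.

Lemma cont_ksub_emb S T (i : S -> T) (oT : topology T) : cont (ksub i oT) oT i.
Proof. by apply: cont_kfy_dom => V oV; exists V. Qed.

Lemma gen_top_topology T (S : set (set T)) : is_topology (gen_top S).
Proof.
split; first by move=> x _; exists [::].
split=> [U V gU gV x [Ux Vx]|F gF x [U FU Ux]].
  have [s1 [s1S s1x s1U]] := gU x Ux; have [s2 [s2S s2x s2V]] := gV x Vx.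
  exists (s1 ++ s2).
  split=> [W /in_app_iff [/s1S|/s2S] //|W /in_app_iff [/s1x|/s2x] //|y s12y].
  by split; [apply: s1U|apply: s2V] => W Ws; apply: s12y; apply/in_app_iff; tauto.
have [s [sS sx sU]] := gF U FU x Ux.
by exists s; split => // y sy; exists U => //; apply: sU.
Qed.

Lemma gen_top_sub T (S : set (set T)) V : S V -> gen_top S V.
Proof.
move=> SV x Vx; exists [:: V].
by split=> [W [<-|[]]|W [<-|[]]|y /(_ V (or_introl erefl))].
Qed.

Lemma cont_gen_top X T (oX : topology X) (S : set (set T)) f :
  is_topology oX -> (forall V, S V -> oX (f @^-1` V)) -> cont oX (gen_top S) f.
Proof.
move=> hX cS W gW.
have sex x : exists s : seq (set T), W (f x) ->
    [/\ forall V, In V s -> S V, forall V, In V s -> V (f x) &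
        (fun y => forall V, In V s -> V y) `<=` W].
  have [Wfx|nWfx] := pselect (W (f x)); last by exists [::].
  by have [s sP] := gW _ Wfx; exists s.
have [s sP] := choice sex.
have -> : f @^-1` W = (fun y => exists x, W (f x) /\
                        (fun z => forall V, In V (s x) -> (f @^-1` V) z) y).
  apply/predeqP => y; split=> [Wfy|[x [Wfx sxy]]]; first by exists y; case: (sP y Wfy).
  by case: (sP x Wfx) => _ _; apply.
apply: open_bigcup_fam => // x Wfx; apply: open_bigcap_seq => // V Vsx.
by case: (sP x Wfx) => + _ _; move/(_ V Vsx)/cS.
Qed.

Lemma cont_pair X A B (oX : topology X) (oA : topology A) (oB : topology B) f g :
  is_topology oX -> cont oX oA f -> cont oX oB g ->
  cont oX (prod_top oA oB) (fun x => (f x, g x)).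
Proof. by move=> hX cf cg; apply: cont_gen_top => // V [[U /cf oU ->]|[U /cg oU ->]]. Qed.

Lemma cont_kprod_fst A B (oA : topology A) (oB : topology B) :
  cont (kprod oA oB) oA fst.
Proof. by move=> W oW; apply/open_kfy/gen_top_sub; left; exists W. Qed.

Lemma prod_top_open_box A B (oA : topology A) (oB : topology B) W y1 y2 :
  is_topology oA -> is_topology oB -> prod_top oA oB W -> W (y1, y2) ->
  exists U1 U2, [/\ oA U1, oB U2, U1 y1, U2 y2 &
     forall z1 z2, U1 z1 -> U2 z2 -> W (z1, z2)].
Proof.
move=> hA hB gW /gW [s [sS sy sW]].
suff [U1 [U2 [oU1 oU2 U1y1 U2y2 U12s]]] : exists U1 U2, [/\ oA U1, oB U2, U1 y1, U2 y2 &
    forall z1 z2, U1 z1 -> U2 z2 -> forall V, In V s -> V (z1, z2)].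
  by exists U1, U2; split => // z1 z2 U1z1 U2z2; apply: sW; apply: U12s.
elim: s sS sy {sW} => [|V s IHs] sS sy.
  by exists setT, setT; split => //; apply: openT.
have [U1 [U2 [oU1 oU2 U1y1 U2y2 U12s]]] :=
  IHs (fun W Ws => sS W (or_intror Ws)) (fun W Ws => sy W (or_intror Ws)).
have Vy := sy V (or_introl erefl).
case: (sS V (or_introl erefl)) => -[U oU eV]; rewrite eV in Vy.
- exists (U1 `&` U), U2; split => //; first exact: openI.
  by move=> z1 z2 [U1z1 Uz1] U2z2 W' [<-|Ws]; [rewrite eV|apply: U12s].
- exists U1, (U2 `&` U); split => //; first exact: openI.
  by move=> z1 z2 U1z1 [U2z2 Uz2] W' [<-|Ws]; [rewrite eV|apply: U12s].
Qed.

(* [maps_into (fun f x => sval f x) K U] is the compact-open subbasic set. *)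
Definition maps_into T X A (a : T -> X -> A) (K : set X) (U : set A) : set T :=
  fun t => forall x, K x -> U (a t x).

Section JointEvaluation.
Variables (X A T1 T2 : Type) (oX : topology X) (oA : topology A)
  (o1 : topology T1) (o2 : topology T2).
Hypotheses (hX : is_topology oX) (hsX : hausdorff oX) (hA : is_topology oA).
Variables (a : T1 -> X -> A) (b : T2 -> X -> A).
Hypotheses (ca : forall t, cont oX oA (a t)) (cb : forall t, cont oX oA (b t)).
Hypotheses (oa : forall K U, compact_in oX K -> oA U -> o1 (maps_into a K U))
           (ob : forall K U, compact_in oX K -> oA U -> o2 (maps_into b K U)).

Definition pair_eval (p : T1 * T2) x := (a p.1 x, b p.2 x).

Lemma prod_top_open_maps_into K W :
  compact_in oX K -> prod_top oA oA W -> prod_top o1 o2 (maps_into pair_eval K W).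
Proof.
move=> cK oW p pKW.
have fex x : exists UU : set A * set A, K x ->
    [/\ oA UU.1, oA UU.2, UU.1 (a p.1 x), UU.2 (b p.2 x) &
        forall z1 z2, UU.1 z1 -> UU.2 z2 -> W (z1, z2)].
  have [Kx|nKx] := pselect (K x); last by exists (setT, setT).
  have [U1 [U2 box]] := prod_top_open_box hA hA oW (pKW x Kx).
  by exists (U1, U2).
have [f fP] := choice fex.
have gex x : exists PK : set X * set X, K x ->
    [/\ oX PK.1, PK.1 x, compact_in oX PK.2,
        PK.2 `<=` a p.1 @^-1` (f x).1 `&` b p.2 @^-1` (f x).2 & PK.1 `&` K `<=` PK.2].
  have [Kx|nKx] := pselect (K x); last by exists (setT, setT).
  have [oU1 oU2 U1x U2x _] := fP x Kx.
  have [P [K' shrink]] := hausdorff_compact_shrink hX hsX cK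
    (openI hX (ca p.1 oU1) (cb p.2 oU2)) (conj U1x U2x).
  by exists (P, K').
have [g gP] := choice gex.
have [xs [xsK Kcov]] := compact_point_subcover (N := fun x => (g x).1) cK
  (fun x Kx => let: And5 oP Px _ _ _ := gP x Kx in conj oP Px).
pose E1 x (q : T1 * T2) := maps_into a (g x).2 (f x).1 q.1.
pose E2 x (q : T1 * T2) := maps_into b (g x).2 (f x).2 q.2.
exists (flat_map (fun x => [:: E1 x; E2 x]) xs); split.
- move=> V /in_flat_map [x [xxs [<-|[<-|[]]]]];
    have [_ _ cK' _ _] := gP x (xsK x xxs); have [oU1 oU2 _ _ _] := fP x (xsK x xxs).
  + by left; exists (maps_into a (g x).2 (f x).1); first exact: oa.
  + by right; exists (maps_into b (g x).2 (f x).2); first exact: ob.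
- move=> V /in_flat_map [x [xxs [<-|[<-|[]]]]] y;
    have [_ _ _ K'U _] := gP x (xsK x xxs); by move/K'U => [].
- move=> q Eq y Ky; have [x [xxs Py]] := Kcov y Ky.
  have [_ _ _ _ K'y] := gP x (xsK x xxs); have [_ _ _ _ U12W] := fP x (xsK x xxs).
  have gxy : (g x).2 y by apply: K'y.
  have E1q : E1 x q by apply: Eq; apply/in_flat_map; exists x; split => //; left.
  have E2q : E2 x q by apply: Eq; apply/in_flat_map; exists x; split => //; right; left.
  exact: U12W (E1q y gxy) (E2q y gxy).
Qed.

Lemma compact_pair_eval_image K Q :
  compact_in oX K -> compact_in (prod_top o1 o2) Q ->
  compact_in (prod_top oA oA) [set pair_eval p x | p in Q & x in K].
Proof.
move=> cK cQ C oC cov.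
have sex p : exists s : seq (set (A * A)), Q p ->
    (forall U, In U s -> C U) /\ pair_eval p @` K `<=` (fun z => exists2 U, In U s & U z).
  have [Qp|nQp] := pselect (Q p); last by exists [::].
  have [s sP] := compact_image cK (cont_pair hX (ca p.1) (cb p.2)) oC
    (fun _ '(ex_intro2 x Kx e) => cov _ (ex_intro2 _ _ p Qp (ex_intro2 _ _ x Kx e))).
  by exists s.
have [s sP] := choice sex.
pose N p := maps_into pair_eval K (fun z => exists U, In U (s p) /\ U z).
have [ps [psQ Qcov]] : exists ps : seq (T1 * T2), (forall p, In p ps -> Q p) /\
    Q `<=` (fun q => exists p, In p ps /\ N p q).
  apply: compact_point_subcover cQ _ => p Qp; split.
    apply: prod_top_open_maps_into cK _.
    by apply: (open_bigcup_fam (gen_top_topology _)) => U /(sP p Qp).1 /oC.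
  by move=> x Kx; have [U Us Uz] := (sP p Qp).2 _ (ex_intro2 _ _ x Kx erefl); exists U.
exists (flat_map s ps); split=> [U /in_flat_map [p [pps Usp]]|_ [q Qq [x Kx <-]]].
  exact: (sP p (psQ p pps)).1 U Usp.
have [p [pps /(_ x Kx) [U [Usp Uz]]]] := Qcov q Qq.
by exists U => //; apply/in_flat_map; exists p.
Qed.

Lemma kprod_open_maps_into K W :
  compact_in oX K -> kprod oA oA W -> kfy (prod_top o1 o2) (maps_into pair_eval K W).
Proof.
move=> cK kW Q cQ.
have [W' oW' eW] := kW _ (compact_pair_eval_image cK cQ).
exists (maps_into pair_eval K W'); first exact: prod_top_open_maps_into.
apply/predeqP => p; split=> -[pKW Qp]; split => // x Kx.
- have [] // : (W' `&` [set pair_eval p x | p in Q & x in K]) (pair_eval p x).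
  by rewrite -eW; split; [apply: pKW|exists p => //; exists x].
- have [] // : (W `&` [set pair_eval p x | p in Q & x in K]) (pair_eval p x).
  by rewrite eW; split; [apply: pKW|exists p => //; exists x].
Qed.
End JointEvaluation.

Lemma cfunctor_inhabited (C D : kcat) :
  is_kcat C -> is_kcat D -> Ob D -> inhabited (cfunctor C D).
Proof.
move=> [kObC kMorC _ _] [_ _ _ [idm_st _ comp_id _]] d; constructor.
have [idm_s idm_t] := idm_st d.
have const_ax : is_functor (fun _ : Ob C => d) (fun _ : Mor C => idm d).
  by split=> // f h _; have [_ /[!idm_t]] := comp_id (idm d).
by apply: (CFunctor const_ax); apply: cont_const; [case: kObC|case: kMorC].
Qed.

Lemma cont_dom_cod (C D : kcat) :
  cont (FuncMor_top C D) (kprod (FuncOb_top C D) (FuncOb_top C D))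
       (fun t => (tdom t, tcod t)).
Proof.
exact: cont_comp (@cont_ksub_emb _ _ (@ctrans_emb C D) _) (@cont_kprod_fst _ _ _ _).
Qed.

Lemma FuncOb_open_maps_into (C D : kcat) K U :
  is_kcat C -> is_kcat D -> compact_in (topOb C) K -> topOb D U ->
  FuncOb_top C D (maps_into (@fo C D) K U).
Proof.
(* F maps K into U iff fm F maps idm @` K into src @^-1` U. *)
move=> [_ _ [_ _ c_idm _] _] [_ _ [c_src _ _ _] [idm_st _ _ _]] cK oU.
have -> : maps_into (@fo C D) K U = @fm_map C D @^-1`
    maps_into (fun (f : cmap (topMor C) (topMor D)) m => sval f m) (idm @` K) (src @^-1` U).
  apply/predeqP => F; have [_ _ iF _] := fun_ax F.
  have srcF x : src (fm F (idm x)) = fo F x by rewrite iF (idm_st _).1.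
  split=> [FKU _ [x Kx <-]|FKU x Kx] /=; first by rewrite srcF; apply: FKU.
  by rewrite -srcF; apply: FKU; exists x.
apply: open_kfy; exists (maps_into (fun f m => sval f m) (idm @` K) (src @^-1` U)) => //.
apply/open_kfy/gen_top_sub; exists (idm @` K), (src @^-1` U); split => //.
- exact: compact_image cK c_idm.
- exact: c_src.
Qed.

Section PerfectCodomain.
Variables C D : kcat.
Hypotheses (hC : is_kcat C) (hD : is_kcat D).
Variable g : Ob D * Ob D -> Mor D.
Hypotheses (gK : cancel (fun f => (src f, tgt f)) g)
           (Kg : cancel g (fun f => (src f, tgt f)))
           (g_cont : cont (kprod (topOb D) (topOb D)) (topMor D) g).

Lemma src_g p : src (g p) = p.1. Proof. by rewrite -[in RHS](Kg p). Qed.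
Lemma tgt_g p : tgt (g p) = p.2. Proof. by rewrite -[in RHS](Kg p). Qed.

Lemma parallel_mor_eq (m1 m2 : Mor D) : src m1 = src m2 -> tgt m1 = tgt m2 -> m1 = m2.
Proof. by move=> es et; rewrite -(gK m1) -(gK m2) /= es et. Qed.

Definition component (F G : cfunctor C D) x := g (fo F x, fo G x).

Lemma component_src F G x : src (component F G x) = fo F x. Proof. exact: src_g. Qed.
Lemma component_tgt F G x : tgt (component F G x) = fo G x. Proof. exact: tgt_g. Qed.

Lemma cont_component F G : cont (topOb C) (topMor D) (component F G).
Proof.
have [kObC _ _ _] := hC.
apply: (cont_kspace_dom kObC); apply: (cont_comp _ g_cont).
apply: cont_kfy; apply: cont_kfy_dom; apply: cont_pair; [by case: kObC|exact: fo_cont..].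
Qed.

Lemma component_nat (F G : cfunctor C D) f :
  Defs.comp (fm F f) (component F G (tgt f)) = Defs.comp (component F G (src f)) (fm G f).
Proof.
(* Both sides are morphisms from F (src f) to G (tgt f). *)
have [_ _ _ [_ comp_st _ _]] := hD.
have [sF tF _ _] := fun_ax F; have [sG tG _ _] := fun_ax G.
have [s1 t1] := comp_st _ _ (etrans (tF f) (esym (component_src F G _))).
have [s2 t2] := comp_st _ _ (etrans (component_tgt F G _) (esym (sG f))).
by apply: parallel_mor_eq; rewrite ?s1 ?s2 ?t1 ?t2 ?sF ?tG ?component_src ?component_tgt.
Qed.

Definition unique_trans (p : cfunctor C D * cfunctor C D) : ctrans C D :=
  CTrans (cont_component p.1 p.2) (component_src p.1 p.2) (component_tgt p.1 p.2)
         (component_nat p.1 p.2).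

Lemma unique_transK : cancel (fun t => (tdom t, tcod t)) unique_trans.
Proof.
case=> F G e ec es et en; rewrite /unique_trans /=.
have ee : e = component F G.
  by apply: funext => x; apply: parallel_mor_eq; rewrite ?component_src ?component_tgt.
by subst e; congr CTrans; apply: Prop_irrelevance.
Qed.

Lemma cont_unique_trans :
  cont (kprod (FuncOb_top C D) (FuncOb_top C D)) (FuncMor_top C D) unique_trans.
Proof.
have [[tObC hsObC _] _ _ _] := hC; have [[tObD _ _] _ _ _] := hD.
have oFo K U : compact_in (topOb C) K -> topOb D U ->
    FuncOb_top C D (maps_into (@fo C D) K U).
  exact: FuncOb_open_maps_into.
have hdom : is_topology (kprod (FuncOb_top C D) (FuncOb_top C D)).
  exact/kfy_topology/gen_top_topology.
apply: cont_kfy; apply: cont_induced; apply: cont_kfy; apply: cont_pair => //.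
  move=> W oW; have -> : (fun p : cfunctor C D * cfunctor C D => (p.1, p.2)) @^-1` W = W.
    by apply/predeqP => -[].
  exact: oW.
apply: cont_kfy; apply: cont_gen_top => // _ [K [U [cK oU ->]]].
exact: (kprod_open_maps_into tObC hsObC tObD (@fo_cont C D) (@fo_cont C D) oFo oFo cK
          (g_cont oU)).
Qed.
End PerfectCodomain.

Theorem mainTheorem5 (C D : kcat) :
  is_kcat C -> is_kcat D -> nonempty_kcat C -> perfect D ->
  perfect_data (FuncOb_top C D) (FuncMor_top C D) (@tdom C D) (@tcod C D).
Proof.
move=> hC hD _ [[d] [g [gK [Kg [_ g_cont]]]]].
split; first exact: cfunctor_inhabited.
exists (unique_trans hC hD gK Kg g_cont); split; last split; last split.
- exact: unique_transK.
- by case.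
- exact: cont_dom_cod.
- exact: cont_unique_trans.
Qed.
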